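(* Given an SB representation of an $n$-vertex graph $G=(V,E)$ based on a biclique partition $\mathcal B$, a cut query with input disjoint sets $S,T\subseteq V$ can be answered in time $O(w(\mathcal B)+|S|+|T|)$.
   Context: All graphs are finite, simple and undirected. A biclique of a graph $G$ is a (not necessarily induced) complete bipartite subgraph $(L,R)$ of $G$ with sides $L,R$. A biclique partition of $G$ is a family $\mathcal B=\{(L_1,R_1),\dots,(L_k,R_k)\}$ of bicliques of $G$ whose edge sets partition $E(G)$; its weight is $w(\mathcal B)=\sum_{i=1}^k(|L_i|+|R_i|)$. The SB (succinct biclique) representation of $G$ based on $\mathcal B$ is a list of the bicliques in $\mathcal B$, where each biclique is stored as two sorted lists of vertices corresponding to its two sides (with their lengths). A cut query with input disjoint subsets $S,T\subseteq V$ asks for the number $c(S,T)$ of edges of $G$ with one endpoint in $S$ and the other in $T$. Running times are in the standard word-RAM model with words of $\Theta(\log n)$ bits. *)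

(* Defs.v *)
From mathcomp Require Import all_boot.

Set Implicit Arguments.
Unset Strict Implicit.
Unset Printing Implicit Defensive.

(** * Graphs and biclique partitions

    A simple graph on the vertex set 'I_n is a symmetric irreflexive
    [e : rel 'I_n]; its edges are the unordered pairs [set x; y]. *)

Definition edge_set n (e : rel 'I_n) : {set {set 'I_n}} :=
  [set E : {set 'I_n} | [exists x, exists y, e x y && (E == [set x; y])]].

Definition bipair n := ({set 'I_n} * {set 'I_n})%type.

Definition biclique_edges n (LR : bipair n) : {set {set 'I_n}} :=
  [set [set x; y] | x in LR.1, y in LR.2].

Definition is_biclique n (e : rel 'I_n) (LR : bipair n) : bool :=
  [disjoint LR.1 & LR.2] && [forall x in LR.1, forall y in LR.2, e x y].

(** The blocks of a [partition] are nonempty, so that both sides of every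
    biclique are nonempty; [uniq] is needed because [[set:: _]] forgets
    repetitions. *)
Definition biclique_partition n (e : rel 'I_n) (B : seq (bipair n)) : Prop :=
  [/\ all (is_biclique e) B,
      uniq [seq biclique_edges LR | LR <- B] &
      partition [set:: [seq biclique_edges LR | LR <- B]] (edge_set e)].

Definition weight n (B : seq (bipair n)) : nat :=
  \sum_(LR <- B) (#|LR.1| + #|LR.2|).

Definition cut n (e : rel 'I_n) (S T : {set 'I_n}) : nat :=
  #|[set E in edge_set e | [exists x in S, exists y in T, E == [set x; y]]]|.

(** * Word RAM

    A word of [b] bits is a natural number smaller than [2 ^ b].  A program is
    a finite list of instructions, so it mentions finitely many registers;
    the memory is indexed by words, since addresses are register contents. *)

Inductive binop :=
  | OpAdd | OpSub | OpMul | OpDiv | OpMod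
  | OpAnd | OpOr | OpXor | OpShl | OpShr
  | OpEq | OpLt.

Inductive instr :=
  | Const (d c : nat)               (* r_d := c *)
  | Op (o : binop) (d x y : nat)    (* r_d := r_x o r_y *)
  | Read (d x : nat)                (* r_d := mem[r_x] *)
  | Write (x y : nat)               (* mem[r_x] := r_y *)
  | Jump (l : nat)
  | JumpZ (x l : nat)               (* jump to l if r_x = 0 *)
  | Halt.

Definition program := seq instr.

Record state := State { pc : nat; reg : nat -> nat; ram : nat -> nat }.

Definition upd (f : nat -> nat) (a v : nat) : nat -> nat :=
  fun i => if i == a then v else f i.

(** Results are reduced modulo [2 ^ b]; division by zero yields 0. *)
Definition eval_op (b : nat) (o : binop) (x y : nat) : nat :=
  match o with
  | OpAdd => x + y
  | OpSub => x + 2 ^ b - y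
  | OpMul => x * y
  | OpDiv => x %/ y
  | OpMod => x %% y
  | OpAnd => Nat.land x y
  | OpOr => Nat.lor x y
  | OpXor => Nat.lxor x y
  | OpShl => x * 2 ^ y
  | OpShr => x %/ 2 ^ y
  | OpEq => x == y
  | OpLt => x < y
  end %% 2 ^ b.

(** Running past the end of the program halts. *)
Definition fetch (P : program) (s : state) : instr := nth Halt P (pc s).

Definition step (b : nat) (P : program) (s : state) : state :=
  let: State p r m := s in
  match fetch P s with
  | Const d c => State p.+1 (upd r d (c %% 2 ^ b)) m
  | Op o d x y => State p.+1 (upd r d (eval_op b o (r x) (r y))) m
  | Read d x => State p.+1 (upd r d (m (r x))) m
  | Write x y => State p.+1 r (upd m (r x) (r y))
  | Jump l => State l r m
  | JumpZ x l => State (if r x == 0 then l else p.+1) r m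
  | Halt => s
  end.

Definition halted (P : program) (s : state) : bool :=
  if fetch P s is Halt then true else false.

Definition init_state (m : nat -> nat) : state := State 0 (fun=> 0) m.

(** Started on memory [m], [P] halts after at most [time] steps of unit cost,
    with the answer [v] in register 0. *)
Definition answers (b : nat) (P : program) (m : nat -> nat) (v time : nat) :=
  exists k, let s := iter k (step b P) (init_state m) in
    [/\ k <= time, halted P s & reg s 0 = v].

(** The input occupies a prefix of the memory; all other cells initially hold
    arbitrary words (no free zero-initialisation). *)
Definition holds_input (b : nat) (inp : seq nat) (m : nat -> nat) : Prop :=
  (forall i, m i < 2 ^ b) /\
  (forall i, i < size inp -> m i = nth 0 inp i).

(** The number of bits of [n] in binary, at least 1. *)
Definition lg (n : nat) : nat := (trunc_log 2 n).+1.

(** * Representation of the input *)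

Definition enc_list n (s : seq 'I_n) : seq nat := size s :: map val s.

(** [enum] lists a subset of 'I_n in increasing order. *)
Definition enc_biclique n (LR : bipair n) : seq nat :=
  enc_list (enum LR.1) ++ enc_list (enum LR.2).

Definition SB n (B : seq (bipair n)) : seq nat :=
  size B :: flatten [seq enc_biclique LR | LR <- B].

(** A query set is passed as a list of its elements, without repetition and in
    no particular order. *)
Definition lists n (s : seq 'I_n) (A : {set 'I_n}) : Prop :=
  uniq s /\ s =i A.

Definition query_input n (B : seq (bipair n)) (s t : seq 'I_n) : seq nat :=
  n :: SB B ++ enc_list s ++ enc_list t.

(* Main.v *)
Require Import Defs.
From mathcomp Require Import all_boot zify.

(** A biclique [(L, R)] of the partition contributes
    [|L :&: S| * |R :&: T| + |L :&: T| * |R :&: S|] edges to the cut: since [L]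
    and [R] are disjoint, its edges are in bijection with [L * R], and since
    [S] and [T] are disjoint, the two ways of crossing exclude each other.  As
    the bicliques partition the edges, the cut is the sum of these numbers
    ([cut_biclique_partition]), and a single pass over the sorted lists computes
    it once membership of a vertex in [S] and in [T] can be tested in constant
    time.

    For this the program keeps one cell per vertex, which should hold 1 on [S],
    2 on [T] and 0 elsewhere.  Two difficulties arise.  The memory is not
    initialised, and clearing [n] cells could cost more than
    [w(B) + |S| + |T|]; but only the vertices that occur in some biclique are
    ever looked up, so that a first pass over the bicliques, clearing the cells
    of the vertices that it meets, is enough.  Next, the length of the input is
    unknown before it is read, so that the cells cannot simply follow it: the
    cell of [v] is counted from the top of the memory, at address
    [2 ^ b - 1 - v].  Every biclique has an edge, so that there are at most
    [n ^ 2] bicliques and the input has [O(n ^ 3)] cells; words of [8 * lg n]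
    bits therefore leave the two areas disjoint, and all counts and partial sums
    below [2 ^ b].

    The program is written in a small language of while loops whose big-step
    semantics [exec] counts machine steps exactly; [exec_compile] transfers
    executions to the word RAM, and [exec_cut_query] is the analysis of the
    query program.  Each vertex occurrence costs a bounded number of steps, and
    so does each biclique, which is paid for by its at least two vertices. *)

Set Implicit Arguments.
Unset Strict Implicit.
Unset Printing Implicit Defensive.

(* Otherwise simplification of a run would expose the reduction modulo 2 ^ b. *)
Local Arguments eval_op : simpl never.

(** * Cuts of biclique partitions *)

(** An edge of a biclique determines its endpoint in [L] and its endpoint in
    [R]. *)
Lemma set2_in_inj n (L R : {set 'I_n}) : [disjoint L & R] ->
  {in setX L R &, injective (fun p : 'I_n * 'I_n => [set p.1; p.2])}.
Proof.
move=> dLR [x y] [x' y'] /setXP[/= xL yR] /setXP[/= xL' yR'] E.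
have N z : z \in L -> z \in R -> False.
  by move=> zL; rewrite (disjointFr dLR zL).
have: x \in [set x'; y'] by rewrite -E set21.
have: y \in [set x'; y'] by rewrite -E set22.
rewrite !inE => /orP[]/eqP ? /orP[]/eqP ?; subst => //.
- by case: (N _ xL' yR).
- by case: (N _ xL' yR).
- by case: (N _ xL yR').
Qed.

(** The crossing edges are the images of the pairs in
    [(L :&: S) * (R :&: T)] and [(L :&: T) * (R :&: S)], two disjoint
    rectangles. *)
Lemma card_biclique_cut n (e : rel 'I_n) (LR : bipair n) (S T : {set 'I_n}) :
  is_biclique e LR -> [disjoint S & T] ->
  #|[set E in biclique_edges LR |
      [exists x in S, exists y in T, E == [set x; y]]]|
  = #|LR.1 :&: S| * #|LR.2 :&: T| + #|LR.1 :&: T| * #|LR.2 :&: S|.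
Proof.
case: LR => L R /andP[/= dLR _] dST.
set f := fun p : 'I_n * 'I_n => [set p.1; p.2].
set X1 := setX (L :&: S) (R :&: T); set X2 := setX (L :&: T) (R :&: S).
have sub : X1 :|: X2 \subset setX L R.
  by apply/subsetP=> -[x y]; rewrite !inE /=; lia.
rewrite -!cardsX -/X1 -/X2 -cardsUI.
have -> : X1 :&: X2 = set0.
  apply/setP=> -[x y]; rewrite !inE /=.
  by apply/negP; case/andP=> /andP[/andP[_ xS] _] /andP[/andP[_ xT] _];
    rewrite (disjointFr dST xS) in xT.
rewrite cards0 addn0.
rewrite -(card_in_imset (sub_in2 (subsetP sub) (set2_in_inj dLR))).
apply: eq_card => E; rewrite !inE; apply/andP/imsetP.
- case=> /imset2P[x y xL yR ->] /existsP[u /andP[uS /existsP[v /andP[vT /eqP]]]].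
  move=> Euv; exists (x, y) => //; rewrite !inE /= xL yR /=.
  have: u \in [set x; y] by rewrite Euv set21.
  have: v \in [set x; y] by rewrite Euv set22.
  have: x \in [set u; v] by rewrite -Euv set21.
  have: y \in [set u; v] by rewrite -Euv set22.
  rewrite !inE => /orP[]/eqP ? /orP[]/eqP ?; subst; rewrite ?uS ?vT ?orbT //.
  + by rewrite (disjointFr dLR xL) in yR.
  + by rewrite (disjointFr dLR xL) in yR.
- case=> -[x y] xy ->; split.
    by move: (subsetP sub _ xy) => /setXP[xL yR]; apply/imset2P; exists x y.
  move: xy; rewrite !inE /= => /orP[]/andP[/andP[_ A] /andP[_ B]].
  + by apply/existsP; exists x; rewrite A; apply/existsP; exists y; rewrite B /=.
  + apply/existsP; exists y; rewrite B; apply/existsP; exists x; rewrite A.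
    by rewrite /f /= setUC.
Qed.

Lemma sum_biclique_partition n (e : rel 'I_n) B (Q : pred {set 'I_n}) :
  biclique_partition e B ->
  #|[set E in edge_set e | Q E]|
  = \sum_(LR <- B) #|[set E in biclique_edges LR | Q E]|.
Proof.
case=> _ uB pB; rewrite -(big_map (@biclique_edges n) predT
  (fun A => #|[set E in A | Q E]|)) big_uniq //=.
have card A : #|[set E in A | Q E]| = \sum_(E in A | Q E) 1.
  by rewrite -sum1_card; apply: eq_bigl => E; rewrite inE.
rewrite card (set_partition_big_cond _ pB).
apply: eq_big => [A | A _]; rewrite ?inE ?card //.
Qed.

Lemma cut_biclique_partition n (e : rel 'I_n) B (S T : {set 'I_n}) :
  biclique_partition e B -> [disjoint S & T] ->
  cut e S T = \sum_(LR <- B)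
    (#|LR.1 :&: S| * #|LR.2 :&: T| + #|LR.1 :&: T| * #|LR.2 :&: S|).
Proof.
move=> pB dST; rewrite /cut (sum_biclique_partition _ pB) !big_seq.
apply: eq_bigr => LR LRB; apply: (@card_biclique_cut _ e) => //.
by case: pB => /allP/(_ _ LRB).
Qed.

Lemma biclique_side_gt0 n (e : rel 'I_n) B LR :
  biclique_partition e B -> LR \in B -> (0 < #|LR.1|) && (0 < #|LR.2|).
Proof.
case=> _ _ /and3P[_ _ /negP n0] LRB; apply/negPn/negP; rewrite negb_and -!eqn0Ngt.
rewrite !cards_eq0 => LR0; apply: n0; rewrite inE; apply/mapP; exists LR => //.
apply/esym/setP=> E; rewrite inE; apply/imset2P=> -[x y].
by case/orP: LR0 => /eqP->; rewrite inE.
Qed.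

Lemma card_edge_set n (e : rel 'I_n) : #|edge_set e| <= n ^ 2.
Proof.
have -> : n ^ 2 = #|{: 'I_n * 'I_n}| by rewrite card_prod card_ord mulnn.
apply: leq_trans (leq_imset_card (fun p => [set p.1; p.2]) _).
apply/subset_leq_card/subsetP=> E; rewrite inE.
case/existsP=> x /existsP[y /andP[_ /eqP->]]; apply/imsetP.
by exists (x, y).
Qed.

(** Bicliques have disjoint, nonempty sets of edges. *)
Lemma size_biclique_partition n (e : rel 'I_n) B :
  biclique_partition e B -> size B <= n ^ 2.
Proof.
move=> pB; apply: leq_trans (card_edge_set e).
have -> : edge_set e = [set E in edge_set e | predT E].
  by apply/setP=> E; rewrite inE andbT.
rewrite (sum_biclique_partition _ pB) -sum1_size !big_seq.
apply: leq_sum => LR LRB; rewrite card_gt0.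
have /andP[/card_gt0P[x xL] /card_gt0P[y yR]] := biclique_side_gt0 pB LRB.
apply/set0Pn; exists [set x; y]; rewrite inE andbT.
by apply/imset2P; exists x y.
Qed.

Lemma double_size_le_weight n (e : rel 'I_n) B :
  biclique_partition e B -> 2 * size B <= weight B.
Proof.
move=> pB; rewrite mulnC -sum1_size big_distrl /weight !big_seq /=.
apply: leq_sum => LR LRB.
by have /andP[] := biclique_side_gt0 pB LRB; apply: leq_add.
Qed.

Lemma weight_biclique_partition n (e : rel 'I_n) B :
  biclique_partition e B -> weight B <= n ^ 2 * (2 * n).
Proof.
move=> /size_biclique_partition sB.
apply: (@leq_trans (size B * (2 * n))); last by rewrite leq_mul2r sB orbT.
rewrite -sum1_size big_distrl /weight /=.
apply: leq_sum => LR _.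
rewrite mul1n mul2n -addnn.
by apply: leq_add; rewrite -[leqRHS](card_ord n) max_card.
Qed.

(** * While programs and their compilation *)

Inductive cmd :=
  | Do (instrs : seq instr)
  | Seq (c d : cmd)
  | While (x : nat) (c : cmd).

Definition straight (i : instr) : bool :=
  match i with Const _ _ | Op _ _ _ _ | Read _ _ | Write _ _ => true
  | _ => false end.

(** The register file is a list, zero beyond its end, so that a straight-line
    run on a concrete list simplifies to a concrete list. *)
Definition config := (seq nat * (nat -> nat))%type.

Definition act (b : nat) (s : config) (i : instr) : config :=
  let: (r, m) := s in
  match i with
  | Const d c => (set_nth 0 r d (c %% 2 ^ b), m)
  | Op o d x y => (set_nth 0 r d (eval_op b o (nth 0 r x) (nth 0 r y)), m)
  | Read d x => (set_nth 0 r d (m (nth 0 r x)), m)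
  | Write x y => (r, upd m (nth 0 r x) (nth 0 r y))
  | _ => s
  end.

(** The number is the exact count of machine steps of the compiled code: a test
    of the loop condition costs 1, and so does the jump back to the test. *)
Inductive exec (b : nat) : cmd -> config -> nat -> config -> Prop :=
  | ExecDo ins s s' :
      all straight ins -> foldl (act b) s ins = s' ->
      exec b (Do ins) s (size ins) s'
  | ExecSeq c d s s' s'' k l :
      exec b c s k s' -> exec b d s' l s'' ->
      exec b (Seq c d) s (k + l) s''
  | ExecExit x c s :
      nth 0 s.1 x = 0 -> exec b (While x c) s 1 s
  | ExecLoop x c s s' s'' k l :
      nth 0 s.1 x != 0 -> exec b c s k s' -> exec b (While x c) s' l s'' ->
      exec b (While x c) s (k + l).+2 s''.

(** Jump targets are absolute, hence the address [l] of the first instruction. *)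
Fixpoint compile (l : nat) (c : cmd) : program :=
  match c with
  | Do ins => ins
  | Seq c d => let p := compile l c in p ++ compile (l + size p) d
  | While x c =>
      let p := compile l.+1 c in
      JumpZ x (l + size p).+2 :: rcons p (Jump l)
  end.

Lemma set_nth_upd (r : nat -> nat) v d x :
  r =1 nth 0 v -> upd r d x =1 nth 0 (set_nth 0 v d x).
Proof. by move=> rv i; rewrite nth_set_nth /upd /= rv. Qed.

Lemma act_step b pre i post r s :
  straight i -> r =1 nth 0 s.1 ->
  exists2 r', r' =1 nth 0 (act b s i).1 &
    step b (pre ++ i :: post) (State (size pre) r s.2) =
      State (size pre).+1 r' (act b s i).2.
Proof.
case: s => v m /= si rv; rewrite /step /fetch /= nth_cat ltnn subnn /=.
case: i si => //= [d c | o d x y | d x | x y] _; rewrite -?rv;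
  (eexists; last reflexivity) => //; exact: set_nth_upd.
Qed.

(** Induction on the execution; the surrounding code is arbitrary because the
    body of a loop, and each half of a sequence, is compiled in place. *)
Lemma exec_compile b c s k s' : exec b c s k s' ->
  forall pre post r, r =1 nth 0 s.1 ->
  exists2 r', r' =1 nth 0 s'.1 &
    let p := compile (size pre) c in
    iter k (step b (pre ++ p ++ post)) (State (size pre) r s.2) =
      State (size pre + size p) r' s'.2.
Proof.
elim=> {c s k s'}.
- move=> ins s s' + <- {s'}.
  elim: ins s => [|i ins IH] s /=.
    by move=> _ pre post r rs; exists r; rewrite ?addn0.
  case/andP=> si sis pre post r rs.
  have [r1 r1s E] := act_step b pre (ins ++ post) si rs.
  have [r2 r2s /= E'] := IH _ sis (rcons pre i) post r1 r1s.
  exists r2 => //; rewrite -iterS iterSr E.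
  by rewrite -cat_rcons -[in LHS](size_rcons pre i) E' size_rcons addnS.
- move=> c d s s' s'' k l _ IHc _ IHd pre post r rs /=.
  have [r1 r1s E1] := IHc pre (compile (size pre + size (compile (size pre) c)) d
                               ++ post) r rs.
  have [r2 r2s E2] := IHd (pre ++ compile (size pre) c) post r1 r1s.
  exists r2 => //; rewrite addnC iterD -catA E1.
  by rewrite size_cat /= -!catA in E2; rewrite E2 size_cat addnA.
- move=> x c s x0 pre post r rs /=; exists r => //.
  by rewrite /step /fetch /= nth_cat ltnn subnn /= rs x0 eqxx size_rcons !addnS.
- move=> x c s s' s'' k l x0 _ IHc _ IHw pre post r rs /=.
  set p := compile _ c; set P := pre ++ _; set j := JumpZ _ _ in P *.
  have EP : P = rcons pre j ++ p ++ Jump (size pre) :: post.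
    by rewrite /P /= !cat_rcons.
  have [r1 r1s /=] := IHc (rcons pre j) (Jump (size pre) :: post) r rs.
  rewrite size_rcons -/p -EP => E1.
  have [r2 r2s /=] := IHw pre post r1 r1s.
  rewrite -/p -/j -/P => E2.
  exists r2 => //; rewrite -E2 -!iterS (_ : (k + l).+2 = l.+1 + k + 1); last by lia.
  rewrite !iterD.
  have -> : iter 1 (step b P) (State (size pre) r s.2) = State (size pre).+1 r s.2.
    by rewrite /step /fetch /P /= nth_cat ltnn subnn /= rs (negbTE x0).
  rewrite E1 iterSr; congr (iter l _ _).
  by rewrite /step /fetch EP /= catA nth_cat size_cat size_rcons ltnn subnn.
Qed.

Lemma exec_answers b c m s k :
  exec b c ([::], m) k s -> answers b (compile 0 c) m (nth 0 s.1 0) k.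
Proof.
move=> /exec_compile /(_ [::] [::] (fun=> 0)) [i|r rs /= E]; first by rewrite nth_nil.
exists k; rewrite cats0 in E; rewrite /init_state E; split=> //=.
by rewrite /halted /fetch nth_default.
Qed.

(** * Input lists and marks in memory *)

Lemma exec_do b ins s s' k :
  all straight ins -> foldl (act b) s ins = s' -> size ins = k ->
  exec b (Do ins) s k s'.
Proof. by move=> ? ? <-; apply: ExecDo. Qed.

Lemma eval_add b x y : x + y < 2 ^ b -> eval_op b OpAdd x y = x + y.
Proof. by move=> xy; rewrite /eval_op modn_small. Qed.

Lemma eval_sub b x y : y <= x < 2 ^ b -> eval_op b OpSub x y = x - y.
Proof.
by case/andP=> yx xb; rewrite /eval_op -addnBAC // modnDr modn_small //; lia.
Qed.

Lemma eval_mul b x y : x * y < 2 ^ b -> eval_op b OpMul x y = x * y.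
Proof. by move=> xy; rewrite /eval_op modn_small. Qed.

Lemma eval_div b x y : x < 2 ^ b -> eval_op b OpDiv x y = x %/ y.
Proof.
by move=> xb; rewrite /eval_op modn_small // (leq_ltn_trans (leq_div _ _)).
Qed.

Lemma eval_mod b x y : x < 2 ^ b -> eval_op b OpMod x y = x %% y.
Proof.
by move=> xb; rewrite /eval_op modn_small // (leq_ltn_trans (leq_mod _ _)).
Qed.

Definition holds (m : nat -> nat) (p : nat) (l : seq nat) : Prop :=
  forall i, i < size l -> m (p + i) = nth 0 l i.

Lemma holds_cons m p x l : holds m p (x :: l) -> m p = x /\ holds m p.+1 l.
Proof.
move=> h; split; first by have := h 0 isT; rewrite addn0.
by move=> i il; rewrite addSnnS; apply: (h i.+1).
Qed.

Lemma holds_cat m p l l' :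
  holds m p (l ++ l') -> holds m p l /\ holds m (p + size l) l'.
Proof.
move=> h; split=> i il.
  by rewrite h ?nth_cat ?il // size_cat ltn_addr.
rewrite -addnA h ?size_cat ?ltn_add2l //.
by rewrite nth_cat ltnNge leq_addr /= addKn.
Qed.

Definition mark_addr b v := 2 ^ b - 1 - v.

Definition marked b w m l := foldl (fun m v => upd m (mark_addr b v) w) m l.

Lemma marked_low b n w m l a :
  all (gtn n) l -> n <= 2 ^ b -> a < 2 ^ b - n -> marked b w m l a = m a.
Proof.
elim: l m => //= v l IH m /andP[vn ln] nb an; rewrite IH // /upd /mark_addr.
by case: eqP => // E; lia.
Qed.

(** On [n] vertices the addresses are distinct, as no subtraction is truncated. *)
Lemma markedE b n w m l v :
  all (gtn n) l -> n <= 2 ^ b -> v < n ->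
  marked b w m l (mark_addr b v) = if v \in l then w else m (mark_addr b v).
Proof.
elim: l m => //= u l IH m /andP[un ln] nb vn; rewrite IH // in_cons.
case: ifP => _; rewrite ?orbT // orbF /upd /mark_addr.
by have -> : (2 ^ b - 1 - v == 2 ^ b - 1 - u) = (v == u) by lia.
Qed.

(** Marking does not disturb the input, which lies below the marks. *)
Lemma holds_marked b n w m l p l' :
  all (gtn n) l -> n <= 2 ^ b -> p + size l' <= 2 ^ b - n ->
  holds m p l' -> holds (marked b w m l) p l'.
Proof.
move=> ln nb pb h i il; rewrite (marked_low _ _ ln) //; first exact: h.
by apply: leq_trans pb; rewrite ltn_add2l.
Qed.

(** Register 0 holds the answer, 1 and 12 the constants 1 and 2, 2 the highest
    address, 3 the address of the next input cell, 4 the number of bicliques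
    left, 5 the number of vertices left in the current list.  Registers 6 and 7
    are scratch, except that 7 is the mark to write while marking.  Registers 8
    and 9 count the vertices of the current list in [S] and in [T], registers 10
    and 11 those of the list before it. *)
Definition regs b ans p k j u w a c a' c' :=
  [:: ans; 1; 2 ^ b - 1; p; k; j; u; w; a; c; a'; c'; 2].

Definition next_cell : seq instr := [:: Op OpAdd 3 3 1; Op OpSub 5 5 1].

Definition enter_list : seq instr := [:: Read 5 3; Op OpAdd 3 3 1].

Definition mark_loop : cmd :=
  While 5 (Do [:: Read 6 3, Op OpSub 6 2 6, Write 6 7 & next_cell]).

Definition mark_list : cmd := Seq (Do enter_list) mark_loop.

Definition tally_loop : cmd :=
  While 5 (Do [:: Read 6 3, Op OpSub 6 2 6, Read 6 6,
                  Op OpMod 7 6 12, Op OpAdd 8 8 7,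
                  Op OpDiv 7 6 12, Op OpAdd 9 9 7 & next_cell]).

(** The two counts of the previous list are first moved to [a'] and [c']. *)
Definition tally_list : cmd :=
  Seq (Do [:: Op OpMul 10 8 1, Op OpMul 11 9 1, Const 8 0, Const 9 0
           & enter_list])
      tally_loop.

(** The [enc_list] of a list of vertices, on their numerical values. *)
Definition enc (l : seq nat) := size l :: l.

Lemma exec_mark_loop b n m ans p k u w a c a' c' l :
  all (gtn n) l -> n <= 2 ^ b -> p + size l < 2 ^ b - n -> holds m p l ->
  exists u', exec b mark_loop
    (regs b ans p k (size l) u w a c a' c', m) (7 * size l).+1
    (regs b ans (p + size l) k 0 u' w a c a' c', marked b w m l).
Proof.
elim: l m p u => [|v l IH] m p u /=.
  by move=> *; exists u; rewrite addn0; apply: ExecExit.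
case/andP=> vn ln nb pb /holds_cons[mp ml].
have [||u' E] := IH (upd m (mark_addr b v) w) p.+1 (mark_addr b v) ln nb.
- lia.
- by apply: (@holds_marked b n w m [:: v]) => //=; rewrite ?vn //; lia.
exists u'; rewrite -addSnnS.
rewrite (_ : (7 * (size l).+1).+1 = (5 + (7 * size l).+1).+2); last by lia.
apply: ExecLoop E => //; apply: exec_do => //=.
rewrite mp !eval_sub ?eval_add; try lia.
by rewrite addn1 [_.+1 - 1]subn1.
Qed.

Lemma exec_mark_list b n m ans p k j u w a c a' c' l :
  all (gtn n) l -> n <= 2 ^ b -> p + (size l).+1 < 2 ^ b - n ->
  holds m p (enc l) ->
  exists u', exec b mark_list
    (regs b ans p k j u w a c a' c', m) (7 * size l + 3)
    (regs b ans (p + (size l).+1) k 0 u' w a c a' c', marked b w m l).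
Proof.
move=> ln nb pb /holds_cons[mp ml].
have [|u' E] := @exec_mark_loop b n m ans p.+1 k u w a c a' c' l ln nb _ ml.
  lia.
exists u'; rewrite -[p + _]addSnnS addn3 -[_.+3]/(2 + (7 * size l).+1).
apply: ExecSeq E; apply: exec_do => //=.
by rewrite mp eval_add ?addn1 //; lia.
Qed.

(** A mark packs two bits, membership in [f] and in [g]; the program unpacks them
    by the remainder and the quotient by 2, without branching. *)
Lemma exec_tally_loop b n m (f g : pred nat) ans p k u w a c a' c' l :
  1 < b -> all (gtn n) l -> n <= 2 ^ b -> p + size l < 2 ^ b - n -> holds m p l ->
  {in l, forall v, m (mark_addr b v) = f v + (g v).*2} ->
  a + size l < 2 ^ b -> c + size l < 2 ^ b ->
  exists u' w', exec b tally_loop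
    (regs b ans p k (size l) u w a c a' c', m) (11 * size l).+1
    (regs b ans (p + size l) k 0 u' w' (a + count f l) (c + count g l) a' c', m).
Proof.
move=> b1; have b4 : 4 <= 2 ^ b by rewrite (@leq_exp2l 2 2).
elim: l p u w a c => [|v l IH] p u w a c /=.
  by move=> *; exists u, w; rewrite !addn0; apply: ExecExit.
case/andP=> vn ln nb pb /holds_cons[mp ml] mfg al cl.
have mv : m (2 ^ b - 1 - v) = f v + (g v).*2 by apply: mfg; rewrite mem_head.
have [||||u' [w' E]] := IH p.+1 (f v + (g v).*2) (g v : nat)
  (a + f v) (c + g v) ln nb _ ml.
- lia.
- by move=> x xl; apply: mfg; rewrite in_cons xl orbT.
- by case: (f v); lia.
- by case: (g v); lia.
exists u', w'; rewrite -[p + _]addSnnS !addnA.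
rewrite (_ : (11 * (size l).+1).+1 = (9 + (11 * size l).+1).+2); last by lia.
apply: ExecLoop E => //; apply: exec_do => //=.
have fg : f v + (g v).*2 < 4 by case: (f v); case: (g v).
have fm : (f v + (g v).*2) %% 2 = f v by case: (f v); case: (g v).
have gd : (f v + (g v).*2) %/ 2 = g v by case: (f v); case: (g v).
rewrite mp [eval_op b OpSub _ v]eval_sub ?mv; last by lia.
rewrite eval_mod ?eval_div ?fm ?gd; try lia.
rewrite eval_sub ?eval_add; try lia; by rewrite addn1 [_.+1 - 1]subn1.
Qed.

Lemma exec_tally_list b n m (f g : pred nat) ans p k j u w a c a' c' l :
  1 < b -> all (gtn n) l -> n <= 2 ^ b -> p + (size l).+1 < 2 ^ b - n ->
  holds m p (enc l) ->
  {in l, forall v, m (mark_addr b v) = f v + (g v).*2} ->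
  a < 2 ^ b -> c < 2 ^ b ->
  exists u' w', exec b tally_list
    (regs b ans p k j u w a c a' c', m) (11 * size l + 7)
    (regs b ans (p + (size l).+1) k 0 u' w' (count f l) (count g l) a c, m).
Proof.
move=> b1 ln nb pb /holds_cons[mp ml] mfg ab cb.
have [|||u' [w' E]] := @exec_tally_loop b n m f g ans p.+1 k u w 0 0
  a c l b1 ln nb _ ml mfg; try lia.
exists u', w'; rewrite -[p + _]addSnnS (_ : _ + 7 = 6 + (11 * size l).+1); last by lia.
apply: ExecSeq E; apply: exec_do => //=.
rewrite !eval_mul ?muln1 // mp eval_add ?addn1 ?mod0n //; lia.
Qed.

(** * The query program *)

Definition enc_pairs (qs : seq (seq nat * seq nat)) : seq nat :=
  flatten [seq enc q.1 ++ enc q.2 | q <- qs].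

Definition vertices (qs : seq (seq nat * seq nat)) : seq nat :=
  flatten [seq q.1 ++ q.2 | q <- qs].

Lemma size_enc l : size (enc l) = (size l).+1.
Proof. by []. Qed.

Lemma enc_pairs_cons l r qs :
  enc_pairs ((l, r) :: qs) = enc l ++ enc r ++ enc_pairs qs.
Proof. exact/esym/catA. Qed.

Lemma leq_size_enc_pairs qs : size qs <= size (enc_pairs qs).
Proof.
by elim: qs => // -[l r] qs IH; rewrite enc_pairs_cons !size_cat size_enc /=; lia.
Qed.

Lemma vertices_cons l r qs : vertices ((l, r) :: qs) = l ++ r ++ vertices qs.
Proof. exact/esym/catA. Qed.

Definition mark_bicliques : cmd :=
  While 4 (Seq mark_list (Seq mark_list (Do [:: Op OpSub 4 4 1]))).

Definition tally_bicliques : cmd :=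
  While 4 (Seq tally_list (Seq tally_list (Do
    [:: Op OpMul 6 10 9; Op OpAdd 0 0 6; Op OpMul 6 11 8; Op OpAdd 0 0 6;
        Op OpSub 4 4 1]))).

Lemma exec_mark_bicliques b n m ans p j u w a c a' c' qs :
  all (gtn n) (vertices qs) -> n <= 2 ^ b ->
  p + size (enc_pairs qs) < 2 ^ b - n -> holds m p (enc_pairs qs) ->
  exists p' j' u', exec b mark_bicliques
    (regs b ans p (size qs) j u w a c a' c', m)
    (\sum_(q <- qs) (7 * (size q.1 + size q.2) + 9)).+1
    (regs b ans p' 0 j' u' w a c a' c', marked b w m (vertices qs))
    /\ p' = p + size (enc_pairs qs).
Proof.
elim: qs m p j u => [|[l r] qs IH] m p j u.
  by move=> *; exists p, j, u; rewrite big_nil addn0; split=> //; apply: ExecExit.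
rewrite vertices_cons enc_pairs_cons !all_cat !size_cat => /and3P[ln rn qn] nb.
rewrite !size_enc => pb /holds_cat[hl /holds_cat[hr hq]].
have [|u1 E1] := @exec_mark_list b n m ans p (size qs).+1 j u w a c a' c'
  l ln nb _ hl; first by lia.
have [||u2 E2] := @exec_mark_list b n (marked b w m l) ans
  (p + (size l).+1) (size qs).+1 0 u1 w a c a' c' r rn nb.
- lia.
- by apply: (holds_marked _ ln) => //=; lia.
have [||p3 [j3 [u3 [E3 Ep]]]] := IH (marked b w (marked b w m l) r)
  (p + (size l).+1 + (size r).+1) 0 u2 qn nb.
- lia.
- apply: (holds_marked _ rn) => //=; first by lia.
  by apply: (holds_marked _ ln) => //=; lia.
exists p3, j3, u3; split; last by rewrite Ep; lia.
rewrite big_cons /=.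
rewrite (_ : (_ + _ + _).+1 =
  (((7 * size l + 3) + ((7 * size r + 3) + 1)) +
   (\sum_(q <- qs) (7 * (size q.1 + size q.2) + 9)).+1).+2); last by lia.
rewrite /marked !foldl_cat; apply: ExecLoop E3 => //.
apply: (ExecSeq E1); apply: (ExecSeq E2); apply: exec_do => //=.
have sq := leq_size_enc_pairs qs.
by rewrite eval_sub ?[_.+1 - 1]subn1 //; lia.
Qed.

(** The partial sums never exceed the final answer, hence do not overflow. *)
Lemma exec_tally_bicliques b n m (f g : pred nat) ans p j u w a c a' c' qs :
  1 < b -> all (gtn n) (vertices qs) -> n <= 2 ^ b ->
  p + size (enc_pairs qs) < 2 ^ b - n -> holds m p (enc_pairs qs) ->
  {in vertices qs, forall v, m (mark_addr b v) = f v + (g v).*2} ->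
  a < 2 ^ b -> c < 2 ^ b ->
  let total := \sum_(q <- qs)
    (count f q.1 * count g q.2 + count g q.1 * count f q.2) in
  ans + total < 2 ^ b ->
  exists r, exec b tally_bicliques
    (regs b ans p (size qs) j u w a c a' c', m)
    (\sum_(q <- qs) (11 * (size q.1 + size q.2) + 21)).+1 (r, m)
    /\ nth 0 r 0 = ans + total.
Proof.
move=> b1; elim: qs ans p j u w a c a' c' => [|[l r] qs IH] ans p j u w a c a' c'.
  rewrite !big_nil => *; eexists; split; first exact: ExecExit.
  by rewrite addn0.
rewrite vertices_cons enc_pairs_cons !all_cat !size_cat => /and3P[ln rn qn] nb.
rewrite !size_enc => pb /holds_cat[hl /holds_cat[hr hq]] mfg ab cb.
rewrite !big_cons /= !addnA => tb.
have mfgl : {in l, forall v, m (mark_addr b v) = f v + (g v).*2}.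
  by move=> v vl; apply: mfg; rewrite !mem_cat vl.
have mfgr : {in r, forall v, m (mark_addr b v) = f v + (g v).*2}.
  by move=> v vr; apply: mfg; rewrite !mem_cat vr orbT.
have mfgq : {in vertices qs, forall v, m (mark_addr b v) = f v + (g v).*2}.
  by move=> v vq; apply: mfg; rewrite !mem_cat vq !orbT.
have [|u1 [w1 E1]] := @exec_tally_list b n m f g ans p (size qs).+1 j u w a c
  a' c' l b1 ln nb _ hl mfgl ab cb; first by lia.
have lf := count_size f l; have l_g := count_size g l.
have rf := count_size f r; have r_g := count_size g r.
have [|||u2 [w2 E2]] := @exec_tally_list b n m f g ans (p + (size l).+1)
  (size qs).+1 0 u1 w1 (count f l) (count g l) a c r b1 rn nb _ hr mfgr;
  try lia.
have [||||s [E3 Es]] := IH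
  (ans + count f l * count g r + count g l * count f r)
  (p + (size l).+1 + (size r).+1) 0 (count g l * count f r) w2
  (count f r) (count g r) (count f l) (count g l) qn nb _ hq mfgq; try lia.
exists s; split; last by rewrite Es.
rewrite (_ : (_ + _ + _).+1 =
  (((11 * size l + 7) + ((11 * size r + 7) + 5)) +
   (\sum_(q <- qs) (11 * (size q.1 + size q.2) + 21)).+1).+2); last by lia.
apply: ExecLoop E3 => //.
apply: (ExecSeq E1); apply: (ExecSeq E2); apply: exec_do => //=.
have sq := leq_size_enc_pairs qs.
rewrite !eval_mul ?eval_add ?eval_sub ?[_.+1 - 1]subn1 //; lia.
Qed.

(** Cell 1 of the input is the number of bicliques and cell 2 begins their
    encoding; [Read 4 1] uses that register 1 holds 1, and register 0 is still 0
    when the top address [0 - 1] is computed. *)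
Definition prologue : seq instr :=
  [:: Const 1 1; Const 12 2; Op OpSub 2 0 1; Const 3 2; Read 4 1].

(** The first pass marks with 0, the initial value of register 7, to clear the
    marks of the vertices that the last pass looks up.  After it register 3
    points to the list of [S], followed by that of [T]. *)
Definition cut_query : cmd :=
  Seq (Do prologue) (Seq mark_bicliques
  (Seq (Do [:: Const 7 1]) (Seq mark_list
  (Seq (Do [:: Const 7 2]) (Seq mark_list
  (Seq (Do [:: Const 3 2; Read 4 1]) tally_bicliques)))))).

(** The sum on the left of the step count gathers both passes over the bicliques.
    Marking [t] after [s] overwrites no mark, since [s] and [t] are disjoint. *)
Lemma exec_cut_query b n m qs (s t : seq nat) :
  let total := \sum_(q <- qs) (count (mem s) q.1 * count (mem t) q.2
    + count (mem t) q.1 * count (mem s) q.2) in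
  let input := n :: (size qs :: enc_pairs qs) ++ enc s ++ enc t in
  1 < b -> all (gtn n) (vertices qs) -> all (gtn n) s -> all (gtn n) t ->
  {in s, forall v, v \notin t} ->
  size input + n < 2 ^ b -> total < 2 ^ b -> holds m 0 input ->
  exists2 r, exec b cut_query ([::], m)
    (\sum_(q <- qs) (18 * (size q.1 + size q.2) + 30)
      + 7 * size s + 7 * size t + 17) r & nth 0 r.1 0 = total.
Proof.
move=> total input b1 qn sn tn dst szb tb.
rewrite /input cat_cons.
case/holds_cons=> _ /holds_cons[m1 /holds_cat[hq /holds_cat[hs ht]]].
move: szb; rewrite /input cat_cons -[size (_ :: _)]/(size _).+2.
rewrite !size_cat !size_enc => szb.
have nb : n <= 2 ^ b by lia.
have b4 : 4 <= 2 ^ b by rewrite (@leq_exp2l 2 2).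
have E0 : exec b (Do prologue) ([::], m) 5 (regs b 0 2 (size qs) 0 0 0 0 0 0 0, m).
  apply: exec_do => //=; rewrite !modn_small; try lia.
  by rewrite /eval_op add0n modn_small ?[m 1]m1 //; lia.
have [|p1 [j1 [u1 [E1 Ep]]]] := @exec_mark_bicliques b n m 0 2 0 0 0 0 0 0 0 qs
  qn nb _ hq; first by lia.
set m0 := marked _ _ _ _ in E1.
have [||u2 E2] := @exec_mark_list b n m0 0 p1 0 j1 u1 1 0 0 0 0 s sn nb.
- lia.
- by rewrite Ep; apply: (holds_marked _ qn) => //; rewrite size_enc; lia.
have [||u3 E3] := @exec_mark_list b n (marked b 1 m0 s) 0 (p1 + (size s).+1) 0 0
  u2 2 0 0 0 0 t tn nb.
- lia.
- apply: (holds_marked _ sn) => //; first by rewrite size_enc; lia.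
  by rewrite Ep; apply: (holds_marked _ qn) => //; rewrite size_enc; lia.
set mt := marked _ _ _ t in E3.
have hqt : holds mt 2 (enc_pairs qs).
  apply: (holds_marked _ tn) => //; first by lia.
  apply: (holds_marked _ sn) => //; first by lia.
  by apply: (holds_marked _ qn) => //; lia.
have mt1 : mt 1 = size qs.
  have lo1 : 1 < 2 ^ b - n by lia.
  by rewrite /mt (marked_low _ _ tn) // (marked_low _ _ sn) // /m0 (marked_low _ _ qn).
have [|||||r [E4 Er]] := @exec_tally_bicliques b n mt (mem s) (mem t) 0 2 0 u3
  2 0 0 0 0 qs b1 qn nb _ hqt; try lia.
- move=> v vq; have vn := allP qn _ vq.
  rewrite /mt (markedE _ _ tn) // (markedE _ _ sn) // /m0 (markedE _ _ qn) // vq /=.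
  (* A vertex of t is not in s: the mark 2 is then 0 + 2, not 1 + 2. *)
  have := dst v; case: (v \in s) => [/(_ isT)/negbTE->|_] //; by case: ifP.
- by rewrite add0n.
exists (r, mt) => //.
have Ew w w' M p j u : w' < 2 ^ b -> exec b (Do [:: Const 7 w'])
    (regs b 0 p 0 j u w 0 0 0 0, M) 1 (regs b 0 p 0 j u w' 0 0 0 0, M).
  by move=> wb; apply: exec_do => //=; rewrite modn_small.
have Ez : exec b (Do [:: Const 3 2; Read 4 1])
  (regs b 0 (p1 + (size s).+1 + (size t).+1) 0 0 u3 2 0 0 0 0, mt) 2
  (regs b 0 2 (size qs) 0 u3 2 0 0 0 0, mt).
  by apply: exec_do => //=; rewrite modn_small ?mt1 //; lia.
rewrite (_ : _ + 17 = 5 + ((\sum_(q <- qs) (7 * (size q.1 + size q.2) + 9)).+1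
  + (1 + ((7 * size s + 3) + (1 + ((7 * size t + 3) + (2 +
    (\sum_(q <- qs) (11 * (size q.1 + size q.2) + 21)).+1))))))); last first.
  rewrite (eq_bigr (fun q => (7 * (size q.1 + size q.2) + 9) +
    (11 * (size q.1 + size q.2) + 21))) => [|q _]; last by lia.
  by rewrite big_split /=; lia.
apply: (ExecSeq E0); apply: (ExecSeq E1); apply: (ExecSeq (Ew _ 1 _ _ _ _ _)).
  by lia.
apply: (ExecSeq E2); apply: (ExecSeq (Ew _ 2 _ _ _ _ _)); first by lia.
by apply: (ExecSeq E3); apply: (ExecSeq Ez).
Qed.

(** * The query on an encoded partition *)

Definition side_lists n (B : seq (bipair n)) : seq (seq nat * seq nat) :=
  [seq (map val (enum LR.1), map val (enum LR.2)) | LR : bipair n <- B].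

Lemma query_inputE n (B : seq (bipair n)) (s t : seq 'I_n) :
  query_input B s t =
  n :: (size (side_lists B) :: enc_pairs (side_lists B))
    ++ enc (map val s) ++ enc (map val t).
Proof.
rewrite /query_input /SB /enc_pairs size_map -map_comp.
rewrite /enc_list /enc !size_map; congr (_ :: (_ :: flatten _) ++ _).
by apply: eq_map => LR; rewrite /enc_biclique /enc_list /enc /= !size_map.
Qed.

Lemma all_ltn_map_val n (s : seq 'I_n) : all (gtn n) (map val s).
Proof. by apply/allP=> _ /mapP[x _ ->]; apply: ltn_ord. Qed.

Lemma vertices_side_lists n (B : seq (bipair n)) :
  all (gtn n) (vertices (side_lists B)).
Proof.
by elim: B => //= LR B IH; rewrite vertices_cons !all_cat !all_ltn_map_val.
Qed.

Lemma count_map_val n (s : seq 'I_n) (A S : {set 'I_n}) :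
  lists s S -> count (mem (map val s)) (map val (enum A)) = #|A :&: S|.
Proof.
case=> _ sS; rewrite count_map -sum1_count big_enum_cond /= -sum1_card.
by apply: eq_bigl => x; rewrite !inE mem_map ?sS //; apply: val_inj.
Qed.

Lemma size_lists n (s : seq 'I_n) (S : {set 'I_n}) : lists s S -> size s = #|S|.
Proof. by case=> us sS; rewrite -(eq_card sS); apply/esym/card_uniqP. Qed.

Lemma sum_side_lists n (B : seq (bipair n)) c d :
  \sum_(q <- side_lists B) (c * (size q.1 + size q.2) + d)
  = c * weight B + size B * d.
Proof.
rewrite big_map /= big_split /= big_const_seq count_predT iter_addn_0 mulnC.
rewrite /weight big_distrr /= mulnC; congr (_ + _).
by apply: eq_bigr => LR _; rewrite !size_map !cardE.
Qed.

Lemma size_enc_pairs qs :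
  size (enc_pairs qs) = \sum_(q <- qs) (1 * (size q.1 + size q.2) + 2).
Proof.
elim: qs => [|[l r] qs IH]; first by rewrite big_nil.
by rewrite enc_pairs_cons big_cons !size_cat !size_enc IH /=; lia.
Qed.

(** The left-hand side bounds the length of the input plus the [n] cells of marks,
    and also the answer. *)
Lemma leq_exp_lg n b : 8 * lg n <= b -> 4 * n ^ 3 + 3 * n + n ^ 2 + 4 < 2 ^ b.
Proof.
move=> lb; apply: (@leq_trans (2 ^ (lg n * 8))); last by rewrite leq_exp2l 1?mulnC.
have nN : n < 2 ^ lg n by apply: trunc_log_ltn.
have N2 : 2 ^ 1 <= 2 ^ lg n by rewrite leq_exp2l.
rewrite expnM; move: (2 ^ lg n) nN N2 => N nN N2.
have n3 : n ^ 3 <= N ^ 3 by rewrite leq_exp2r // ltnW.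
have N3 : 2 ^ 3 <= N ^ 3 by rewrite leq_exp2r.
have n2 : n ^ 2 <= N ^ 3.
  by apply: (@leq_trans (N ^ 2)); [rewrite leq_exp2r // ltnW | rewrite leq_exp2l].
have n1 : n <= N ^ 3.
  by apply: (leq_trans (ltnW nN)); rewrite -{1}(expn1 N) leq_exp2l.
have N8 : 8 * 4 * N ^ 3 <= N ^ 8.
  rewrite (_ : N ^ 8 = N ^ 3 * N ^ 2 * N ^ 3); last by rewrite -!expnD.
  by rewrite leq_mul2r leq_mul ?orbT // (@leq_exp2r 2 N 2).
by move: N8 n1 n2 n3 N3; lia.
Qed.

Theorem mainTheorem12 :
  exists lo : nat, forall hi : nat, exists (P : program) (C : nat),
  forall (n b : nat) (e : rel 'I_n) (B : seq (bipair n))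
    (S T : {set 'I_n}) (s t : seq 'I_n) (m : nat -> nat),
    lo * lg n <= b <= hi * lg n ->
    symmetric e -> irreflexive e ->
    biclique_partition e B ->
    [disjoint S & T] ->
    lists s S -> lists t T ->
    holds_input b (query_input B s t) m ->
    answers b P m (cut e S T) (C * (weight B + #|S| + #|T|).+1).
Proof.
exists 8 => hi; exists (compile 0 cut_query), 33.
move=> n b e B S T s t m /andP[lob _] _ _ pB dST sS tT [_ hm].
have [sizeS sizeT] := (size_lists sS, size_lists tT).
have [ltS ltT] := (max_card S, max_card T); rewrite !card_ord in ltS ltT.
have w2 := double_size_le_weight pB.
have w3 : weight B <= 2 * n ^ 3.
  by apply: leq_trans (weight_biclique_partition pB) _; rewrite mulnCA -expnSr.
have big := leq_exp_lg lob.
have b1 : 1 < b by apply: leq_trans lob; rewrite (@leq_mul 2 1).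
have dst : {in map val s, forall v, v \notin map val t}.
  move=> _ /mapP[x xs ->]; rewrite mem_map; last exact: val_inj.
  by rewrite tT.2 (disjointFr dST) // -sS.2.
have Ecut : cut e S T = \sum_(q <- side_lists B)
    (count (mem (map val s)) q.1 * count (mem (map val t)) q.2
     + count (mem (map val t)) q.1 * count (mem (map val s)) q.2).
  rewrite (cut_biclique_partition pB dST) big_map /=.
  by apply: eq_bigr => LR _; rewrite !(count_map_val _ sS, count_map_val _ tT).
have cutb : cut e S T < 2 ^ b.
  have : cut e S T <= #|edge_set e|.
    by apply/subset_leq_card/subsetP=> E; rewrite inE => /andP[].
  by have := card_edge_set e; lia.
rewrite query_inputE in hm.
have [||r E Er] := exec_cut_query b1 (vertices_side_lists B) (all_ltn_map_val s)
  (all_ltn_map_val t) dst _ _ hm; last 1 first.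
- rewrite Ecut -Er; have [k [kE h v]] := exec_answers E.
  (* 33 w(B) = 18 w(B) + 30 w(B) / 2, as |B| <= w(B) / 2 *)
  exists k; split=> //; apply: leq_trans kE _.
  by rewrite sum_side_lists !size_map sizeS sizeT; lia.
- rewrite -!cat_cons !size_cat !size_enc !size_map /= size_enc_pairs sum_side_lists.
  by rewrite sizeS sizeT; lia.
- by rewrite -Ecut.
Qed.
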